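(* Let $Q$ be an absolutely continuous stochastic algorithm with Hamiltonian $H$. Assume that for every $h\in\mathcal{H}$ there is $\rho(h)>0$ such that $\mathbb{E}\left[e^{\lambda(h(X)-\mathbb{E}[h(X')])}\right]\le e^{\lambda^2\rho(h)^2/2}$ for all $\lambda\in\mathbb{R}$, and that there is $\sigma>0$ such that for all $\lambda\in\mathbb{R}$, $k\in[n]$, $h\in\mathcal{H}$ and $\mathbf{x}\in\mathcal{X}^n$, $$\mathbb{E}_{X\sim\mu}\left[e^{\lambda\left(H(h,S^k_X\mathbf{x})-\mathbb{E}_{X'\sim\mu}[H(h,S^k_{X'}\mathbf{x})]\right)}\right]\le e^{\lambda^2\sigma^2/2}.$$ Then for $\delta>0$, with probability at least $1-\delta$ as $\mathbf{X}\sim\mu^n$ and $h\sim Q_{\mathbf{X}}$, $$\Delta(h,\mathbf{X})\le \rho(h)\left(\sqrt{32}\,\sigma+\sqrt{\frac{4\ln(1/\delta)}{n}}\right).$$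
   Context: $\mathcal{X}$ is a measurable space with probability measure $\mu$, $\mathbf{X}=(X_1,\dots,X_n)\sim\mu^n$, $X,X'\sim\mu$ independent. $\mathcal{H}$ is a measurable space of measurable functions $h:\mathcal{X}\to[0,\infty)$ with nonnegative a-priori measure $\pi$. A stochastic algorithm $Q:\mathbf{x}\mapsto Q_{\mathbf{x}}$ (probability measures on $\mathcal{H}$) is absolutely continuous if each $Q_{\mathbf{x}}$ and $\pi$ are mutually absolutely continuous. A measurable $H:\mathcal{H}\times\mathcal{X}^n\to\mathbb{R}$ is a Hamiltonian for $Q$ if $dQ_{\mathbf{x}}(h)=e^{H(h,\mathbf{x})}d\pi(h)/Z(\mathbf{x})$ with $Z(\mathbf{x})=\int_{\mathcal{H}}e^{H(h,\mathbf{x})}d\pi(h)$ finite and positive. $[n]=\{1,\dots,n\}$; $S^k_y\mathbf{x}$ replaces the $k$-th coordinate of $\mathbf{x}$ by $y$. Generalization gap: $\Delta(h,\mathbf{x})=\mathbb{E}[h(X)]-\frac1n\sum_{i=1}^n h(x_i)$. Probability ''as $\mathbf{X}\sim\mu^n$ and $h\sim Q_{\mathbf{X}}$'' is w.r.t. the joint law. All functions are assumed to have finite exponential moments of all orders (and $\int_{\mathcal{H}}e^{\mathbb{E}[H(h,\mathbf{X})]}d\pi(h)$ is finite and positive). *)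

(* Defs.v *)
From HB Require Import structures.
From mathcomp Require Import all_boot all_order all_algebra.
From mathcomp Require Import all_classical all_reals all_analysis.
Set Implicit Arguments. Unset Strict Implicit. Unset Printing Implicit Defensive.
Import Order.TTheory GRing.Theory Num.Theory.
Local Open Scope classical_set_scope.
Local Open Scope ring_scope.

Section defs.
Context {d : measure_display} {T : measurableType d} {R : realType}.

(* Iterated integral w.r.t. mu over n.-tuples:  the integral w.r.t. mu^n
   (by Tonelli/Fubini). *)
Fixpoint iter_int (mu : {measure set T -> \bar R}) (n : nat)
  : (n.-tuple T -> \bar R) -> \bar R :=
  match n return ((n.-tuple T -> \bar R) -> \bar R) with
  | 0 => fun f => f [tuple]
  | m.+1 => fun f => (\int[mu]_x iter_int mu (fun t => f (cons_tuple x t)))%E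
  end.

Definition replace_at (n : nat) (x : n.-tuple T) (k : 'I_n) (y : T)
  : n.-tuple T := [tuple (if i == k then y else tnth x i) | i < n].

End defs.

Definition joint_prob {d1 d2 : measure_display} {T : measurableType d1}
  {Hs : measurableType d2} {R : realType} (mu : {measure set T -> \bar R})
  (n : nat) (Q : n.-tuple T -> probability Hs R)
  (E : n.-tuple T -> Hs -> Prop) : \bar R :=
  iter_int mu (fun x => Q x [set h | E x h]).

Definition gen_gap {d1 d2 : measure_display} {T : measurableType d1}
  {Hs : measurableType d2} {R : realType} (mu : {measure set T -> \bar R})
  (ev : Hs -> T -> R) (n : nat) (h : Hs) (x : n.-tuple T) : R :=
  (\int[mu]_y ev h y) - (n%:R)^-1 * \sum_(i < n) ev h (tnth x i).

(* Main.v *)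
Require Import Defs.
From HB Require Import structures.
From mathcomp Require Import all_boot all_order all_algebra.
From mathcomp Require Import all_classical all_reals all_analysis.
From mathcomp Require Import measurable_realfun ring lra.
Import Order.TTheory GRing.Theory Num.Theory.
Local Open Scope classical_set_scope.
Local Open Scope ring_scope.

(** Write [D(h, x) = H(h, x) - E H(h, X)], let [Q0] be the Gibbs law with density
    proportional to [exp (E H(h, X))], and let [M(x)] be the [Q0]-mean of
    [exp (D(., x))], so that [dQ_x = exp (D(., x)) / M(x) dQ0].  By convexity
    [M(x)^-4] is at most the [Q0]-mean of [exp (-4 D(., x))].  On the bad event
    [Delta / rho > t], for [lam >= 0],
      [exp D / M <= exp (lam (Delta / rho - t)) exp D / M],
    and the weighted AM-GM inequality [u v s <= u^2/2 + v^4/4 + s^4/4] separates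
    the three exponentials.  After Tonelli, it remains to bound for each fixed
    [h] the moments [E exp (2 lam Delta / rho) <= exp (2 lam^2 / n)] and
    [E exp (+-4 D) <= exp (8 n sigma^2)]; the latter is the martingale bound,
    where Jensen's inequality transfers the sub-Gaussian bound from the lines
    [y |-> H(h, S^k_y x)] to the martingale increments.  With [lam = n t / 2]
    the bad event has probability at most
    [exp (4 n sigma^2 - n t^2 / 4) <= delta]. *)

(** * The product law on tuples and its agreement with iterated integration *)

Section power_probability.
Context {d : measure_display} {T : measurableType d} {R : realType}.
Variable mu : probability T R.

Definition cons_pair n (p : T * n.-tuple T) : n.+1.-tuple T :=
  cons_tuple p.1 p.2.

Lemma measurable_cons_pair n : measurable_fun setT (@cons_pair n).
Proof. exact: measurable_cons. Qed.

HB.instance Definition _ n :=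
  isMeasurableFun.Build _ _ _ _ (@cons_pair n) (measurable_cons_pair n).

(** Taking the image of a binary product under consing follows the recursion of [iter_int], while
    the Fubini and Tonelli theorems apply at each step. *)
Fixpoint power_prob n : probability (n.-tuple T) R :=
  match n with
  | 0 => \d_([tuple] : 0.-tuple T)
  | m.+1 => distribution (mu \x power_prob m)%E (@cons_pair m)
  end.

Local Open Scope ereal_scope.

Lemma ge0_integral_powerS n (f : n.+1.-tuple T -> \bar R) :
  measurable_fun [set: n.+1.-tuple T] f -> (forall x, 0 <= f x) ->
  \int[power_prob n.+1]_x f x =
  \int[mu]_x \int[power_prob n]_t f (cons_tuple x t).
Proof.
move=> mf f0; rewrite ge0_integral_distribution// fubini_tonelli1//=.
exact: measurableT_comp (measurable_cons_pair n).
Qed.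

Lemma integrable_powerS n (f : n.+1.-tuple T -> \bar R) :
  (power_prob n.+1).-integrable setT f ->
  (mu \x power_prob n).-integrable setT (f \o @cons_pair n).
Proof.
move=> /integrableP[mf foo]; apply/integrableP; split.
  exact: measurableT_comp (measurable_cons_pair n).
rewrite ge0_integral_distribution// in foo.
exact: measurableT_comp.
Qed.

Lemma integral_powerS n (f : n.+1.-tuple T -> \bar R) :
  (power_prob n.+1).-integrable setT f ->
  \int[power_prob n.+1]_x f x =
  \int[mu]_x \int[power_prob n]_t f (cons_tuple x t).
Proof.
move=> fi; have mf := measurable_int _ fi.
rewrite integral_distribution//; last exact: integrable_powerS.
by rewrite -integral12_prod_meas1//; exact: integrable_powerS.
Qed.

(** For signed [f] the integral is by definition the difference of the integrals of its positive and
    negative parts, and Tonelli's theorem makes each of these measurable in the parameter. *)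
Lemma measurable_integral_param d' (X : measurableType d')
    d'' (Y : measurableType d'') (m : {sigma_finite_measure set Y -> \bar R})
    (f : X * Y -> \bar R) :
  measurable_fun setT f -> measurable_fun setT (fun x => \int[m]_y f (x, y)).
Proof.
move=> mf; rewrite (_ : (fun x => _) =
    (fun x => \int[m]_y f^\+ (x, y)) \- (fun x => \int[m]_y f^\- (x, y))).
  by apply: emeasurable_funB; apply: measurable_fun_fubini_tonelli_F => //;
    [exact: measurable_funepos|exact: measurable_funeneg].
apply/funext => x; rewrite [LHS]integralE.
under eq_integral do rewrite funepos_comp/=.
by under [X in _ - X = _]eq_integral do rewrite funeneg_comp/=.
Qed.

(** The induction generalizes the parameter space: the first coordinate of the tuple becomes one
    more parameter beside [x]. *)
Lemma measurable_iter_int n d' (X : measurableType d')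
    (f : X * n.-tuple T -> \bar R) :
  measurable_fun setT f ->
  measurable_fun setT (fun x => iter_int mu (fun t => f (x, t))).
Proof.
elim: n d' X f => [|n IH] d' X f mf /=.
  by apply: measurableT_comp => //; exact: measurable_fun_pair.
pose g (p : (X * T) * n.-tuple T) := f (p.1.1, cons_tuple p.1.2 p.2).
apply: (@measurable_integral_param _ _ _ _ mu
  (fun q => iter_int mu (fun t => g (q, t)))).
apply: IH; apply: measurableT_comp => //.
apply: measurable_fun_pair; first exact: measurableT_comp.
by apply: measurable_cons => //; exact: measurableT_comp.
Qed.

Lemma ge0_iter_intE n (f : n.-tuple T -> \bar R) :
  measurable_fun [set: n.-tuple T] f -> (forall x, 0 <= f x) ->
  iter_int mu f = \int[power_prob n]_x f x.
Proof.
elim: n f => [|n IH] f mf f0 /=.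
  by rewrite integral_dirac// diracT mul1e.
rewrite (ge0_integral_powerS n f)//; apply: eq_integral => x _; apply: IH => //.
by apply: measurableT_comp => //; exact: measurable_cons.
Qed.

(** Almost every section of an integrable function is integrable, so the induction hypothesis
    applies at almost every head, which suffices under the outer integral. *)
Lemma iter_intE n (f : n.-tuple T -> \bar R) :
  (power_prob n).-integrable setT f ->
  iter_int mu f = \int[power_prob n]_x f x.
Proof.
elim: n f => [|n IH] f fi.
  by rewrite /= integral_dirac ?diracT ?mul1e//; exact: measurable_int fi.
have fi' := integrable_powerS _ _ fi.
rewrite integral_powerS//=; apply: ae_eq_integral => //.
- by apply: (measurable_iter_int n _ _ (f \o @cons_pair n));
    exact: measurable_int fi'.
- exact: measurable_fubini_F fi'.
- by apply: filterS (ae_integrable1 fi') => x fx _; exact: IH.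
Qed.

End power_probability.

Section curried_measurability.
Context {d1 d2 d3 : measure_display} {X : measurableType d1}
  {Y : measurableType d2} {Z : measurableType d3}.
Variable f : X -> Y -> Z.
Hypothesis mf : measurable_fun [set: X * Y] (fun p => f p.1 p.2).

Lemma measurable_curryl x : measurable_fun [set: Y] (f x).
Proof. exact: (measurableT_comp mf (pair1_measurable x)). Qed.

Lemma measurable_curryr y : measurable_fun [set: X] (f^~ y).
Proof. exact: (measurableT_comp mf (pair2_measurable y)). Qed.

End curried_measurability.

(** * Integrals of exponentials: normalization, Jensen's inequality, integrability *)

Section exponential_moments.
Context {d : measure_display} {T : measurableType d} {R : realType}.
Local Open Scope ereal_scope.

Lemma measurable_expRE (f : T -> R) : measurable_fun setT f ->
  measurable_fun setT (fun x => (expR (f x))%:E).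
Proof. by move=> mf; apply/measurable_EFinP; exact: measurableT_comp. Qed.

Lemma integral_expR_ge0 (P : {measure set T -> \bar R}) (f : T -> R) :
  0 <= \int[P]_x (expR (f x))%:E.
Proof. exact: integral_ge0. Qed.

Lemma integral_prob_cst (P : probability T R) (r : R) :
  \int[P]_x r%:E = r%:E.
Proof.
rewrite (integral_cst P (measurableT : measurable [set: T]) r%:E).
by rewrite [X in _ * X](probability_setT P) mule1.
Qed.

Lemma integral_prob_le (P : probability T R) (f : T -> \bar R) (r : R) :
  measurable_fun setT f -> (forall x, 0 <= f x) -> (forall x, f x <= r%:E) ->
  \int[P]_x f x <= r%:E.
Proof.
by move=> mf f0 fr; rewrite -(integral_prob_cst P r); exact: ge0_le_integral.
Qed.

Lemma integral_expRB_le (P : {measure set T -> \bar R}) (f : T -> R) (c : R) :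
  measurable_fun setT f -> \int[P]_x (expR (f x))%:E <= (expR c)%:E ->
  \int[P]_x (expR (f x - c))%:E <= 1.
Proof.
move=> mf fc.
rewrite (eq_integral (fun x => (expR (- c))%:E * (expR (f x))%:E)) => [|x _]; last first.
  by rewrite -EFinM -expRD addrC.
rewrite ge0_integralZl//; last exact: measurable_expRE.
apply: le_trans (lee_wpmul2l _ fc) _; first by rewrite lee_fin expR_ge0.
by rewrite -EFinM -expRD addNr expR0.
Qed.

(** The weights are those of [mul3_le]; they sum to 1, so the bound 1 survives the mixture. *)
Lemma integral_expR_mix_le (P : {measure set T -> \bar R}) (f g k : T -> R) :
  measurable_fun setT f -> measurable_fun setT g -> measurable_fun setT k ->
  \int[P]_x (expR (f x))%:E <= 1 -> \int[P]_x (expR (g x))%:E <= 1 ->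
  \int[P]_x (expR (k x))%:E <= 1 ->
  \int[P]_x (2^-1 * expR (f x) + 4^-1 * expR (g x) + 4^-1 * expR (k x))%:E <= 1.
Proof.
move=> mf mg mk f1 g1 k1.
pose s (c : R) (u : T -> R) x := c%:E * (expR (u x))%:E.
have s0 c u x : (0 <= c)%R -> 0 <= s c u x.
  by move=> c0; rewrite /s -EFinM lee_fin mulr_ge0 ?expR_ge0.
have ms c u : measurable_fun setT u -> measurable_fun setT (s c u).
  by move=> mu; apply: measurable_funeM; exact: measurable_expRE.
have sle c u : (0 <= c)%R -> measurable_fun setT u ->
    \int[P]_x (expR (u x))%:E <= 1 -> \int[P]_x s c u x <= c%:E.
  move=> c0 mu u1; rewrite ge0_integralZl//; last exact: measurable_expRE.
  by rewrite -[leRHS]mule1 lee_wpmul2l.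
rewrite (eq_integral (fun x => s 2^-1%R f x + s 4^-1%R g x + s 4^-1%R k x)) => [|x _]//.
rewrite ge0_integralD//; last 4 first.
- by move=> x _; rewrite adde_ge0// s0.
- by apply: emeasurable_funD; exact: ms.
- by move=> x _; rewrite s0.
- exact: ms.
rewrite ge0_integralD//; last 4 first.
- by move=> x _; rewrite s0.
- exact: ms.
- by move=> x _; rewrite s0.
- exact: ms.
have -> : 1 = (2^-1 + 4^-1 + 4^-1)%R%:E :> \bar R by congr EFin; field.
by rewrite !EFinD; apply: leeD; [apply: leeD|]; apply: sle.
Qed.

(** Jensen's inequality: the tangent at the mean, [expR m * (1 + f x - m)], lies below [expR (f x)]
    and integrates to [expR m]. *)
Lemma expR_Rintegral_le (P : probability T R) (f : T -> R) :
  P.-integrable setT (EFin \o f) ->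
  (expR (\int[P]_x f x))%:E <= \int[P]_x (expR (f x))%:E.
Proof.
move=> fi; have mf : measurable_fun setT f.
  by apply/measurable_EFinP; exact: measurable_int fi.
have mexp := measurable_expRE _ mf.
set m := (\int[P]_x f x)%R.
have [->|expfoo] := eqVneq (\int[P]_x (expR (f x))%:E) +oo; first by rewrite leey.
have ei : P.-integrable setT (EFin \o (fun x => expR (f x))).
  apply/integrableP; split => //.
  under eq_integral do rewrite /= ger0_norm ?expR_ge0//.
  by rewrite ltey.
have gi : P.-integrable setT (EFin \o (fun x => expR m * (1 + f x - m)))%R.
  rewrite (_ : _ \o _ = fun x => (expR m)%:E * (((1 - m)%R%:E + (f x)%:E))).
    apply: integrableZl => //; apply: integrableD => //.
    exact: finite_measure_integrable_cst.
  by apply/funext => x /=; congr EFin; ring.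
have -> : (expR m)%:E = \int[P]_x (EFin \o (fun x => expR m * (1 + f x - m))%R) x.
  rewrite (_ : _ \o _ = fun x => (expR m)%:E * (((1 - m)%R%:E + (f x)%:E))).
    rewrite integralZl//; last first.
      apply: integrableD => //; exact: finite_measure_integrable_cst.
    rewrite integralD//; last exact: finite_measure_integrable_cst.
    rewrite integral_prob_cst -(fineK (integrable_fin_num measurableT fi)).
    by rewrite -EFinD -EFinM; congr EFin; rewrite -[fine _]/m; ring.
  by apply/funext => x /=; congr EFin; ring.
apply: le_integral => // x _; rewrite lee_fin/=.
have -> : expR (f x) = (expR m * expR (f x - m))%R by rewrite -expRD; congr expR; ring.
rewrite ler_pM2l ?expR_gt0//; apply: le_trans (expR_ge1Dx _).
by rewrite -addrA.
Qed.

(** By [1 + y <= expR y] at [f x] and [- f x], the absolute value of [f x] is at most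
    [expR (f x) + expR (- f x)]. *)
Lemma integrable_expR (P : {measure set T -> \bar R}) (f : T -> R) :
  measurable_fun setT f ->
  \int[P]_x (expR (f x))%:E < +oo -> \int[P]_x (expR (- f x))%:E < +oo ->
  P.-integrable setT (EFin \o f).
Proof.
move=> mf ep en.
have mN : measurable_fun setT (fun x => - f x)%R by exact: measurableT_comp.
apply/integrableP; split; first exact/measurable_EFinP.
apply: (@le_lt_trans _ _ (\int[P]_x ((expR (f x))%:E + (expR (- f x))%:E))).
  apply: ge0_le_integral => //.
  - by apply: measurableT_comp => //; exact/measurable_EFinP.
  - by apply: emeasurable_funD; exact: measurable_expRE.
  - move=> x _; rewrite /= -EFinD lee_fin.
    have h1 := expR_ge1Dx (f x); have h2 := expR_ge1Dx (- f x)%R.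
    have h3 := expR_ge0 (f x); have h4 := expR_ge0 (- f x)%R.
    by case: (ger0P (f x)) => f0; lra.
by rewrite ge0_integralD//=; [rewrite lte_add_pinfty|exact: measurable_expRE|exact: measurable_expRE].
Qed.

End exponential_moments.

(** * Coordinate replacement on a tuple split into head and tail *)

Section replace_at_cons.
Context {d : measure_display} {T : measurableType d}.

Lemma replace_at_cons0 n (x y : T) (t : n.-tuple T) :
  replace_at (cons_tuple x t) ord0 y = cons_tuple y t.
Proof.
apply: eq_from_tnth => i; rewrite tnth_mktuple.
by case: (unliftP ord0 i) => [j ->|->] //=; rewrite !tnthS.
Qed.

Lemma replace_at_consS n (x y : T) (t : n.-tuple T) (k : 'I_n) :
  replace_at (cons_tuple x t) (lift ord0 k) y = cons_tuple x (replace_at t k y).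
Proof.
apply: eq_from_tnth => i; rewrite tnth_mktuple.
case: (unliftP ord0 i) => [j ->|->] //=.
by rewrite !tnthS tnth_mktuple (inj_eq lift_inj).
Qed.

End replace_at_cons.

(** * Moment generating functions under the product law *)

Section subgaussian.
Context {d : measure_display} {T : measurableType d} {R : realType}.
Variable mu : probability T R.
Local Open Scope ereal_scope.

Lemma integral_power_prod n (g : T -> R) :
  measurable_fun setT g -> (forall y, (0 <= g y)%R) ->
  \int[power_prob mu n]_x (\prod_(i < n) g (tnth x i))%R%:E =
  (\int[mu]_y (g y)%:E) ^+ n.
Proof.
move=> mg g0; elim: n => [|n IH].
  under eq_integral do rewrite big_ord0.
  by rewrite integral_prob_cst expe0.
rewrite ge0_integral_powerS//; last 2 first.
- apply/measurable_EFinP; apply: measurable_prod => i _.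
  by apply: measurableT_comp => //; exact: measurable_tnth.
- by move=> x; rewrite lee_fin prodr_ge0.
transitivity (\int[mu]_x ((g x)%:E * (\int[mu]_y (g y)%:E) ^+ n)).
  apply: eq_integral => x _; rewrite -IH -ge0_integralZl//; last 3 first.
  - apply/measurable_EFinP; apply: measurable_prod => i _.
    by apply: measurableT_comp => //; exact: measurable_tnth.
  - by move=> t _; rewrite lee_fin prodr_ge0.
  - by rewrite lee_fin.
  apply: eq_integral => t _; rewrite big_ord_recl/= EFinM.
  by under eq_bigr do rewrite tnthS.
rewrite ge0_integralZr//; last 3 first.
- exact/measurable_EFinP.
- by move=> x _; rewrite lee_fin.
- by rewrite expe_ge0// integral_ge0// => x _; rewrite lee_fin.
by rewrite expeS.
Qed.

(** Martingale method, by induction on the number of coordinates. For head [x] and tail [t], [f - m]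
    splits into [fx x t - e], with [e] the mean over tails, and [e - m]. The first part falls to the
    induction hypothesis for [fx x]. The second is the tail mean of [fx x t - mb t], so Jensen's
    inequality reduces it to fluctuations of the head with [t] fixed, which [hf] bounds. *)
Lemma power_mgf_le n (f : n.-tuple T -> R) (l c : R) :
  measurable_fun [set: n.-tuple T] f ->
  (power_prob mu n).-integrable setT (EFin \o f) ->
  (forall (k : 'I_n) x,
    \int[mu]_y (expR (l * (f (replace_at x k y)
      - (\int[mu]_y' f (replace_at x k y'))%R)))%:E <= (expR c)%:E) ->
  \int[power_prob mu n]_x (expR (l * (f x
      - (\int[power_prob mu n]_x' f x')%R)))%:E <= (expR (n%:R * c))%:E.
Proof.
elim: n f => [|n IH] f mf fi hf.
  rewrite mul0r expR0.
  set m := (\int[_]_x' f x')%R.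
  have -> : m = f [tuple].
    by rewrite /m /Rintegral integral_dirac ?diracT ?mul1e//; exact/measurable_EFinP.
  rewrite integral_dirac ?diracT ?mul1e ?subrr ?mulr0 ?expR0//.
  apply/measurable_EFinP; apply: measurableT_comp => //.
  by apply: measurable_funM => //; apply: measurable_funB.
set m := (\int[_]_x' f x')%R.
pose pn := power_prob mu n.
have fi' := integrable_powerS mu n _ fi.
pose fx x (t : n.-tuple T) := f (cons_tuple x t).
pose mb (t : n.-tuple T) := (\int[mu]_x fx x t)%R.
have mfx2 : measurable_fun [set: T * n.-tuple T] (fun p => fx p.1 p.2).
  by apply: measurableT_comp => //; exact: measurable_cons_pair.
have mfx x : measurable_fun [set: n.-tuple T] (fx x).
  by apply: measurableT_comp => //; exact: measurable_cons.
have mfxt t : measurable_fun [set: T] (fx ^~ t).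
  by apply: measurableT_comp => //; exact: measurable_cons.
have mmb : measurable_fun [set: n.-tuple T] mb.
  apply: measurableT_comp => //.
  exact: measurable_fubini_G fi'.
have mE1 (a : R) : measurable_fun [set: T * n.-tuple T]
    (fun p => (expR (l * (fx p.1 p.2 - a)))%:E).
  by apply: measurable_expRE; apply: measurable_funM => //; exact: measurable_funB.
have mE2 : measurable_fun [set: T * n.-tuple T]
    (fun p => (expR (l * (fx p.1 p.2 - mb p.2)))%:E).
  apply: measurable_expRE; apply: measurable_funM => //; apply: measurable_funB => //.
  exact: measurableT_comp.
have mbi : pn.-integrable setT (EFin \o mb).
  apply/integrableP; split; first exact/measurable_EFinP.
  have /(integrable21ltyP mu pn (measurable_int _ fi')) := fi'; apply: le_lt_trans.
  apply: ge0_le_integral => //.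
  - by apply: measurableT_comp => //; exact/measurable_EFinP.
  - apply: (measurable_fun_fubini_tonelli_G (abse \o ((EFin \o f) \o cons_pair n))); last first.
      by move=> p; exact: abse_ge0.
    by apply: measurableT_comp => //; exact: measurable_int fi'.
  - move=> t _; apply: le_trans (le_abse_integral _ _ _) => //=.
      (* [fine] sends an infinite integral to 0, so it never increases the absolute value. *)
      by rewrite /mb /Rintegral; case: (\int[mu]_x (fx x t)%:E) => [r| |]//=;
        rewrite leey.
    by apply/measurable_EFinP; exact: mfxt.
(* Fubini's theorem; [mb t] agrees with the extended-real inner integral wherever the section at [t]
   is integrable, hence almost everywhere. *)
have Emb : (\int[pn]_t mb t)%R = m.
  rewrite /m /Rintegral integral_powerS// (Fubini fi'); congr fine.
  apply: ae_eq_integral => //.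
  - exact/measurable_EFinP.
  - exact: measurable_fubini_G fi'.
  - apply: filterS (ae_integrable2 fi') => t ti _ /=.
    by rewrite fineK//; exact: integrable_fin_num ti.
rewrite ge0_integral_powerS//; last first.
  by apply: measurable_expRE; apply: measurable_funM => //; exact: measurable_funB.
apply: (@le_trans _ _ (\int[mu]_x ((expR (n%:R * c))%:E *
   \int[pn]_t (expR (l * (fx x t - mb t)))%:E))).
  apply: ae_ge0_le_integral => //.
  - by move=> x _; exact: integral_expR_ge0.
  - exact: (measurable_fun_fubini_tonelli_F _ (mE1 m)).
  - by move=> x _; apply: mule_ge0 => //; exact: integral_expR_ge0.
  - apply: measurable_funeM.
    exact: (measurable_fun_fubini_tonelli_F _ mE2).
  apply: filterS (ae_integrable1 fi') => x xi _.
  set e := (\int[pn]_t fx x t)%R.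
  have -> : \int[pn]_t (expR (l * (f (cons_tuple x t) - m)))%:E =
      (expR (l * (e - m)))%:E * \int[pn]_t (expR (l * (fx x t - e)))%:E.
    rewrite -ge0_integralZl//; last first.
      by apply: measurable_expRE; apply: measurable_funM => //; exact: measurable_funB.
    apply: eq_integral => t _; rewrite -EFinM -expRD; congr (expR _)%:E.
    by rewrite /fx; ring.
  rewrite muleC; apply: lee_pmul => //.
  - exact: integral_expR_ge0.
  - apply: IH => // k t.
    have := hf (lift ord0 k) (cons_tuple x t).
    by under eq_integral do (rewrite replace_at_consS; under eq_Rintegral do rewrite replace_at_consS).
  have di : pn.-integrable setT (EFin \o (fun t => fx x t - mb t)%R).
    by apply: (integrableB _ xi mbi).
  have -> : (l * (e - m))%R = (\int[pn]_t (l * (fx x t - mb t)))%R.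
    by rewrite RintegralZl// RintegralB// Emb.
  apply: expR_Rintegral_le.
  exact: (integrableZl _ _ di).
rewrite ge0_integralZl//; last 2 first.
- exact: (measurable_fun_fubini_tonelli_F _ mE2).
- by move=> x _; exact: integral_expR_ge0.
rewrite (fubini_tonelli _ mE2)//= -natr1 mulrDl mul1r expRD EFinM lee_pmul2l ?lte_fin ?expR_gt0//.
apply: integral_prob_le.
- exact: (measurable_fun_fubini_tonelli_G _ mE2).
- by move=> t; exact: integral_expR_ge0.
(* The head is overwritten by the replacement, so [point] is an arbitrary filler. *)
- move=> t; have := hf ord0 (cons_tuple point t).
  by under eq_integral do (rewrite replace_at_cons0; under eq_Rintegral do rewrite replace_at_cons0).
Qed.

End subgaussian.

(** * Polynomial inequalities of AM-GM type *)

Lemma amgm5 (R : realFieldType) (u r : R) : 0 <= u -> 0 <= r ->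
  5 * r ^+ 4 * u <= u ^+ 5 + 4 * r ^+ 5.
Proof.
move=> u0 r0; rewrite -subr_ge0.
(* The difference is [u ^+ 5] minus its tangent line at [r], hence the double root. *)
have -> : u ^+ 5 + 4 * r ^+ 5 - 5 * r ^+ 4 * u =
  (u - r) ^+ 2 * (u ^+ 3 + 2 * r * u ^+ 2 + 3 * r ^+ 2 * u + 4 * r ^+ 3) by ring.
by rewrite mulr_ge0 ?sqr_ge0// !addr_ge0 ?mulr_ge0 ?exprn_ge0.
Qed.

(** One square separates [u] from [v * s], a second one separates [v ^+ 2] from [s ^+ 2]. *)
Lemma mul3_le (R : realFieldType) (u v s : R) :
  u * v * s <= 2^-1 * u ^+ 2 + 4^-1 * v ^+ 4 + 4^-1 * s ^+ 4.
Proof.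
have h1 := sqr_ge0 (u - v * s); have h2 := sqr_ge0 (v ^+ 2 - s ^+ 2).
rewrite -subr_ge0.
have -> : 2^-1 * u ^+ 2 + 4^-1 * v ^+ 4 + 4^-1 * s ^+ 4 - u * v * s =
  2^-1 * (u - v * s) ^+ 2 + 4^-1 * (v ^+ 2 - s ^+ 2) ^+ 2 by field.
lra.
Qed.

(** * Gibbs densities and their partition functions *)

Section gibbs.
Context {d : measure_display} {T : measurableType d} {R : realType}.
Local Open Scope ereal_scope.

Lemma measurable_set_ler (f g : T -> R) :
  measurable_fun setT f -> measurable_fun setT g ->
  measurable [set x | (f x <= g x)%R].
Proof.
move=> mf mg; have := measurable_fun_ler mf mg measurableT (_ : measurable [set true]).
by rewrite setTI; apply.
Qed.

(** The sets where [f] is at least [k.+1%:R^-1] exhaust the space and have finite measure by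
    Markov's inequality. *)
Lemma sigma_finite_integrable_gt0 (pi : {measure set T -> \bar R}) (f : T -> R) :
  measurable_fun setT f -> (forall h, (0 < f h)%R) ->
  \int[pi]_h (f h)%:E < +oo -> sigma_finite setT pi.
Proof.
move=> mf f0 foo.
have mF k : measurable [set h | (k.+1%:R^-1 <= f h)%R].
  exact: measurable_set_ler.
exists (fun k => [set h | (k.+1%:R^-1 <= f h)%R]).
  apply/seteqP; split => // h _.
  have [k kf] := ltr_add_invr (f0 h).
  by exists k => //=; rewrite add0r in kf; exact: ltW.
move=> k; split => //.
have k0 : (0 < k.+1%:R^-1 :> R)%R by rewrite invr_gt0.
rewrite -(@lte_pmul2l _ (k.+1%:R^-1)%:E) ?lte_fin//.
apply: (@le_lt_trans _ _ (\int[pi]_h (f h)%:E)); last first.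
  by rewrite gt0_muley ?lte_fin.
rewrite -(integral_cst pi (mF k)).
apply: (@le_trans _ _ (\int[pi]_(h in [set h | (k.+1%:R^-1 <= f h)%R]) (f h)%:E)).
  apply: ge0_le_integral => //.
  - by move=> h _; rewrite /= lee_fin ltW.
  - by apply/measurable_EFinP; exact: measurable_funTS.
apply: ge0_subset_integral => //.
- exact/measurable_EFinP.
- by move=> h _; rewrite lee_fin ltW.
Qed.

Variable pi : {measure set T -> \bar R}.
Variables (H E : T -> R).
Hypotheses (mH : measurable_fun setT H) (mE : measurable_fun setT E).
Variables (Z Z0 : R).
Hypotheses (ZH : \int[pi]_h (expR (H h))%:E = Z%:E)
  (ZE : \int[pi]_h (expR (E h))%:E = Z0%:E) (Z_gt0 : (0 < Z)%R) (Z0_gt0 : (0 < Z0)%R).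

(** Jensen's inequality for the inverse fourth power under the density [expR E / Z0], for which
    [expR (H - E)] has mean [Z / Z0]. Its tangent-line form is [amgm5] with [u = expR (E h - H h)]
    and [r = Z0 / Z], weighted by [expR (H h)]; after integration [r * Z = Z0] leaves
    [Z0 * r ^+ 4]. *)
Lemma inv_partition_le :
  (Z0 * (Z0 / Z) ^+ 4)%:E <= \int[pi]_h (expR (E h + 4 * (E h - H h)))%:E.
Proof.
have [r rE] : exists r : R, r = (Z0 / Z)%R by eexists.
rewrite -rE; have r0 : (0 <= r)%R by rewrite rE divr_ge0 ?ltW.
set W := (X in _ <= X).
have mW : measurable_fun setT (fun h => (expR (E h + 4 * (E h - H h)))%:E).
  apply: measurable_expRE; apply: measurable_funD => //.
  by apply: measurable_funM => //; exact: measurable_funB.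
have : \int[pi]_h ((5 * r ^+ 4)%:E * (expR (E h))%:E) <=
    \int[pi]_h ((expR (E h + 4 * (E h - H h)))%:E + (4 * r ^+ 5)%:E * (expR (H h))%:E).
  apply: ge0_le_integral => //.
  - by move=> h _; rewrite -EFinM lee_fin mulr_ge0 ?expR_ge0// mulr_ge0// exprn_ge0.
  - by apply: measurable_funeM; exact: measurable_expRE.
  - apply: emeasurable_funD => //.
    by apply: measurable_funeM; exact: measurable_expRE.
  - move=> h _; rewrite -!EFinM -EFinD lee_fin.
    have := ler_wpM2r (expR_ge0 (H h)) (amgm5 _ (expR (E h - H h)) r (expR_ge0 _) r0).
    have -> : (expR (E h + 4 * (E h - H h)) = expR (E h - H h) ^+ 5 * expR (H h))%R.
      by rewrite -expRM_natl -expRD; congr expR; ring.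
    have -> : (expR (E h) = expR (E h - H h) * expR (H h))%R.
      by rewrite -expRD subrK.
    by move: r (expR (E h - H h)) (expR (H h)) {r0 rE} => r u v; lra.
rewrite ge0_integralZl//; [|exact: measurable_expRE|]; last first.
  by rewrite lee_fin mulr_ge0 ?exprn_ge0.
rewrite ge0_integralD//; last 2 first.
- by move=> h _; rewrite -EFinM lee_fin !mulr_ge0 ?exprn_ge0 ?expR_ge0.
- by apply: measurable_funeM; exact: measurable_expRE.
rewrite ge0_integralZl//; [|exact: measurable_expRE|]; last first.
  by rewrite lee_fin mulr_ge0 ?exprn_ge0.
rewrite ZH ZE -/W -!EFinM -leeBlDr// -EFinB; apply: le_trans.
rewrite lee_fin le_eqVlt; apply/orP; left; apply/eqP; rewrite rE.
by field; rewrite gt_eqF.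
Qed.

(** On the bad event [B] the factor [expR (a h)] is at least 1 and can be inserted. The shifts [p]
    and [q] will normalize the three exponentials; the prefactor repays [p] for [a], and [q] once
    for [H - E] and once for the ratio of partition functions. *)
Lemma gibbs_event_le (a : T -> R) (B : set T) (p q : R) :
  measurable_fun setT a -> measurable B -> (forall h, B h -> (0 <= a h)%R) ->
  \int[pi]_(h in B) (expR (H h) / Z)%:E <=
  (expR (p + 2 * q) / Z0)%:E * \int[pi]_h (expR (E h) *
    (2^-1 * expR (2 * (a h - p)) + 4^-1 * expR (4 * (H h - E h - q))
      + 4^-1 * expR (4 * (E h - H h - q))))%:E.
Proof.
move=> ma mB a0; have [r rE] : exists r : R, r = (Z0 / Z)%R by eexists.
have r0 : (0 <= r)%R by rewrite rE divr_ge0 ?ltW.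
set K := expR (p + 2 * q).
have K0 : (0 <= K / Z0)%R by rewrite divr_ge0 ?expR_ge0 ?ltW.
pose G h := (expR (E h) *
   (2^-1 * expR (2 * (a h - p)) + 4^-1 * expR (4 * (H h - E h - q))))%R.
have G0 h : (0 <= G h)%R.
  by rewrite mulr_ge0 ?expR_ge0// addr_ge0// mulr_ge0// ?expR_ge0// invr_ge0.
have mG : measurable_fun setT (fun h => (G h)%:E).
  apply/measurable_EFinP; apply: measurable_funM; first exact: measurableT_comp.
  apply: measurable_funD; apply: measurable_funM => //; apply: measurableT_comp => //;
    apply: measurable_funM => //; apply: measurable_funB => //.
  exact: measurable_funB.
pose c := (4^-1 * expR (- (4 * q)))%R.
have c0 : (0 <= c)%R by rewrite mulr_ge0 ?expR_ge0.
have -> : \int[pi]_h (expR (E h) *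
    (2^-1 * expR (2 * (a h - p)) + 4^-1 * expR (4 * (H h - E h - q))
      + 4^-1 * expR (4 * (E h - H h - q))))%:E =
    \int[pi]_h (G h)%:E + c%:E * \int[pi]_h (expR (E h + 4 * (E h - H h)))%:E.
  have mW : measurable_fun setT (fun h => (expR (E h + 4 * (E h - H h)))%:E).
    apply: measurable_expRE; apply: measurable_funD => //.
    by apply: measurable_funM => //; exact: measurable_funB.
  rewrite -ge0_integralZl//.
  rewrite -ge0_integralD//; last 3 first.
  - by move=> h _; rewrite lee_fin.
  - by move=> h _; rewrite -EFinM lee_fin mulr_ge0 ?expR_ge0.
  - exact: measurable_funeM.
  apply: eq_integral => h _; rewrite -EFinM -EFinD; congr EFin.
  rewrite /G /c [in RHS]expRD.
  rewrite (_ : expR (4 * (E h - H h - q)) = expR (4 * (E h - H h)) * expR (- (4 * q)))%R.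
    by ring.
  by rewrite -expRD; congr expR; ring.
have step : \int[pi]_h (G h)%:E + c%:E * (Z0 * r ^+ 4)%:E <=
    \int[pi]_h (G h)%:E + c%:E * \int[pi]_h (expR (E h + 4 * (E h - H h)))%:E.
  by rewrite leeD2l// lee_wpmul2l ?lee_fin// rE; exact: inv_partition_le.
apply: le_trans (lee_wpmul2l _ step); last by rewrite lee_fin.
(* The constant is spread over [h] with weight [expR (E h)], so that the remaining inequality can be
   proved pointwise on [B]. *)
have -> : c%:E * (Z0 * r ^+ 4)%:E = \int[pi]_h ((c * r ^+ 4)%:E * (expR (E h))%:E).
  rewrite ge0_integralZl//; [|exact: measurable_expRE|]; last first.
    by rewrite lee_fin mulr_ge0 ?exprn_ge0.
  by rewrite ZE -!EFinM; congr EFin; ring.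
have cE0 h : 0 <= (c * r ^+ 4)%:E * (expR (E h))%:E.
  by rewrite -EFinM lee_fin !mulr_ge0 ?expR_ge0 ?exprn_ge0.
have mcE : measurable_fun setT (fun h => (c * r ^+ 4)%:E * (expR (E h))%:E).
  by apply: measurable_funeM; exact: measurable_expRE.
rewrite -ge0_integralD//; last by move=> h _; rewrite lee_fin.
have S0 h : 0 <= (G h)%:E + (c * r ^+ 4)%:E * (expR (E h))%:E.
  by rewrite adde_ge0// lee_fin.
have mS : measurable_fun setT (fun h => (G h)%:E + (c * r ^+ 4)%:E * (expR (E h))%:E).
  exact: emeasurable_funD.
rewrite -ge0_integralZl//.
apply: (@le_trans _ _ (\int[pi]_(h in B)
    ((K / Z0)%:E * ((G h)%:E + (c * r ^+ 4)%:E * (expR (E h))%:E)))); last first.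
  apply: ge0_subset_integral => //; first exact: measurable_funeM.
  by move=> h _; rewrite mule_ge0// lee_fin.
apply: ge0_le_integral => //.
- by move=> h _; rewrite lee_fin divr_ge0 ?expR_ge0 ?ltW.
- apply/measurable_EFinP; apply: measurable_funM => //.
  by apply: measurableT_comp => //; exact: measurable_funTS.
- by apply: measurable_funTS; exact: measurable_funeM.
move=> h Bh; rewrite -!EFinM lee_fin.
(* The factors are [expR a], the weight ratio [expR (H - E)] and the partition ratio [r], each
   carrying its share of [p + 2 * q]. *)
have amgm := mul3_le _ (expR (a h - p)) (expR (H h - E h - q)) (r * expR (- q))%R.
have -> : (K / Z0 * (G h + c * r ^+ 4 * expR (E h)) =
   K * expR (E h) / Z0 * (2^-1 * expR (a h - p) ^+ 2
     + 4^-1 * expR (H h - E h - q) ^+ 4 + 4^-1 * (r * expR (- q)) ^+ 4))%R.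
  rewrite /G /c -!mulrN exprMn -!expRM_natl; ring.
apply: le_trans (ler_wpM2l _ amgm); last first.
  by rewrite divr_ge0 ?mulr_ge0 ?expR_ge0 ?ltW.
have -> : (K * expR (E h) / Z0 *
    (expR (a h - p) * expR (H h - E h - q) * (r * expR (- q))) =
   expR (a h) * (expR (H h) / Z))%R.
  rewrite rE; transitivity (K * expR (E h) *
    (expR (a h - p) * expR (H h - E h - q) * expR (- q)) / Z)%R.
    by field; rewrite !gt_eqF.
  rewrite -!expRD mulrA -expRD; congr (expR _ / _)%R; ring.
apply: ler_peMl; first by rewrite divr_ge0 ?expR_ge0 ?ltW.
by apply: le_trans (expR_ge1Dx _); rewrite lerDl a0.
Qed.


End gibbs.

Lemma lee_expe (R : realDomainType) n (x y : \bar R) :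
  (0 <= x -> x <= y -> x ^+ n <= y ^+ n)%E.
Proof.
move=> x0 xy; elim: n => [|n IH]; first by rewrite !expe0.
by rewrite !expeS lee_pmul// expe_ge0.
Qed.

(** * The generalization gap for a fixed hypothesis *)

Section generalization_gap.
Context {d1 d2 : measure_display} {T : measurableType d1}
  {Hs : measurableType d2} {R : realType}.
Variables (mu : probability T R) (ev : Hs -> T -> R).
Hypothesis ev_meas : measurable_fun [set: Hs * T] (fun p => ev p.1 p.2).
Local Open Scope ereal_scope.

Lemma measurable_gen_gap n :
  measurable_fun [set: Hs * n.-tuple T] (fun p => gen_gap mu ev p.1 p.2).
Proof.
apply: measurable_funB.
  apply: (@measurableT_comp _ _ _ _ _ _ (fun h => \int[mu]_y ev h y)%R) => //.
  apply: measurableT_comp => //.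
  apply: (measurable_integral_param _ _ _ _ mu (fun p => (ev p.1 p.2)%:E)).
  exact/measurable_EFinP.
apply: measurable_funM => //; apply: measurable_sum => i.
apply: (measurableT_comp (f := fun p : Hs * T => ev p.1 p.2)
  (g := fun p : Hs * n.-tuple T => (p.1, tnth p.2 i))) => //.
apply: measurable_fun_pair => //.
apply: (measurableT_comp (f := fun x : n.-tuple T => tnth x i)) => //.
exact: measurable_tnth.
Qed.

(** The gap is minus the average of [n] independent centred terms: each coordinate contributes its
    moment at [- (l / n)], and the [n]-th power turns [(l / n) ^+ 2] into [l ^+ 2 / n]. *)
Lemma gen_gap_mgf_le n (h : Hs) (r : R) : (0 < n)%N ->
  (forall l : R, \int[mu]_y (expR (l * (ev h y - (\int[mu]_y' ev h y')%R)))%:E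
     <= (expR (l ^+ 2 * r ^+ 2 / 2))%:E) ->
  forall l : R, \int[power_prob mu n]_x (expR (l * gen_gap mu ev h x))%:E
     <= (expR (l ^+ 2 * r ^+ 2 / (2 * n%:R)))%:E.
Proof.
move=> n0 hh l; set m := (\int[mu]_y ev h y)%R.
have nR0 : n%:R != 0%R :> R by rewrite pnatr_eq0 -lt0n.
pose l1 := (- (l / n%:R))%R.
have -> : \int[power_prob mu n]_x (expR (l * gen_gap mu ev h x))%:E =
    \int[power_prob mu n]_x (\prod_(i < n) expR (l1 * (ev h (tnth x i) - m)))%R%:E.
  apply: eq_integral => x _; congr EFin; rewrite -expR_sum; congr expR.
  rewrite -mulr_sumr sumrB sumr_const card_ord /gen_gap -/m /l1 -mulr_natr.
  by field.
rewrite (integral_power_prod mu n (fun y => expR (l1 * (ev h y - m)))); last 2 first.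
- apply: measurableT_comp => //; apply: measurable_funM => //.
  apply: measurable_funB => //.
  exact: (measurable_curryl ev ev_meas).
- by move=> y; exact: expR_ge0.
apply: (@le_trans _ _ ((expR (l1 ^+ 2 * r ^+ 2 / 2))%:E ^+ n)%E).
  by apply: lee_expe; [exact: integral_expR_ge0|exact: hh].
rewrite -EFin_expe lee_fin -expRM_natl /l1.
rewrite le_eqVlt; apply/orP; left; apply/eqP; congr expR.
by field.
Qed.

End generalization_gap.

(** Once the square is expanded, 32 / 4 = 8 covers the coefficient 4 of [n * s ^+ 2], the second
    root contributes exactly [- L], and the subtracted cross term is nonnegative. *)
Lemma chernoff_exponent_le (R : rcfType) (n s L : R) : 0 < n -> 0 <= s -> 0 <= L ->
  4 * n * s ^+ 2 - n * (Num.sqrt 32 * s + Num.sqrt (4 * L / n)) ^+ 2 / 4 <= - L.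
Proof.
move=> n0 s0 L0; set u := Num.sqrt 32; set v := Num.sqrt _.
have u2 : u ^+ 2 = 32 by rewrite sqr_sqrtr.
have v2 : v ^+ 2 = 4 * L / n by rewrite sqr_sqrtr// divr_ge0 ?mulr_ge0// ltW.
have uv : 0 <= n * (u * s * v) by rewrite !mulr_ge0 ?sqrtr_ge0// ltW.
have ns : 0 <= n * s ^+ 2 by rewrite mulr_ge0 ?sqr_ge0// ltW.
have -> : 4 * n * s ^+ 2 - n * (u * s + v) ^+ 2 / 4 =
  4 * n * s ^+ 2 - (n * s ^+ 2 * u ^+ 2 / 4 + n * (u * s * v) / 2 + n * v ^+ 2 / 4).
  by field.
have nv : n * v ^+ 2 = 4 * L by rewrite v2; field; rewrite gt_eqF.
rewrite u2 nv; lra.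
Qed.

(** * The joint law of sample and hypothesis *)

Section joint_law.
Context {d1 d2 : measure_display} {T : measurableType d1}
  {Hs : measurableType d2} {R : realType}.
Variables (mu : probability T R) (n : nat) (Q : n.-tuple T -> probability Hs R).
Local Open Scope ereal_scope.

(** The masses of the event and of its complement together integrate to 1, so bounding the bad event
    is enough. *)
Lemma joint_prob_ge (E : n.-tuple T -> Hs -> Prop) (delta : R) :
  (forall x, measurable [set h | E x h]) ->
  measurable_fun [set: n.-tuple T] (fun x => Q x [set h | E x h]) ->
  \int[power_prob mu n]_x Q x (~` [set h | E x h]) <= delta%:E ->
  (1 - delta)%:E <= joint_prob mu Q E.
Proof.
move=> mE mQ bad.
have QC x : Q x (~` [set h | E x h]) = 1 - Q x [set h | E x h].
  by rewrite probability_setC.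
rewrite /joint_prob ge0_iter_intE// EFinB leeBlDr//.
apply: (@le_trans _ _ (\int[power_prob mu n]_x Q x [set h | E x h] +
    \int[power_prob mu n]_x Q x (~` [set h | E x h]))%E); last by rewrite leeD2l.
rewrite -ge0_integralD//; last first.
  under eq_fun do rewrite QC.
  by apply: emeasurable_funB.
rewrite (eq_integral (cst 1)) ?integral_prob_cst// => x _.
by rewrite QC /= addeC subeK// fin_num_measure.
Qed.

Variables (pi : {sigma_finite_measure set Hs -> \bar R}) (H : Hs -> n.-tuple T -> R).
Hypothesis H_meas : measurable_fun [set: Hs * n.-tuple T] (fun p => H p.1 p.2).
Hypothesis Z_pos : forall x, 0 < \int[pi]_h (expR (H h x))%:E.
Hypothesis Z_fin : forall x, \int[pi]_h (expR (H h x))%:E < +oo.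
Hypothesis Q_ham : forall x A, measurable A ->
  Q x A = \int[pi]_(h in A)
     (expR (H h x) / fine (\int[pi]_g (expR (H g x))%:E))%:E.

(** [Q] is a bare family of probabilities, so its measurability in the sample is derived from the
    Gibbs density by Tonelli's theorem. Dividing by the partition function becomes subtracting its
    logarithm in the exponent, a form whose measurability is immediate. *)
Lemma measurable_gibbs_section (A : set (Hs * n.-tuple T)) : measurable A ->
  measurable_fun [set: n.-tuple T] (fun x => Q x [set h | A (h, x)]).
Proof.
move=> mA.
pose lnZ x := ln (fine (\int[pi]_g (expR (H g x))%:E)).
have mlnZ : measurable_fun [set: n.-tuple T] lnZ.
  apply: measurableT_comp => //; apply: measurableT_comp => //.
  apply: (measurable_fun_fubini_tonelli_G (fun p => (expR (H p.1 p.2))%:E)) => //.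
  exact: measurable_expRE.
pose f (p : Hs * n.-tuple T) := (\1_A p * expR (H p.1 p.2 - lnZ p.2))%:E.
have mf : measurable_fun [set: Hs * n.-tuple T] f.
  apply/measurable_EFinP; apply: measurable_funM => //.
  apply: measurableT_comp => //; apply: measurable_funB => //.
  exact: measurableT_comp.
rewrite (_ : (fun x => _) = fubini_G pi f); last first.
  apply/funext => x; rewrite Q_ham; last first.
    rewrite (_ : [set h | _] = ysection A x); first exact: measurable_ysection.
    by apply/seteqP; split => h; rewrite /ysection /= inE.
  rewrite integral_mkcond /fubini_G; apply: eq_integral => h _.
  rewrite patchE /f indicE /=.
  have -> : (h \in [set h | A (h, x)]) = ((h, x) \in A).
    by apply/idP/idP; rewrite !inE.
  case: ifPn => _; rewrite ?mul0r// mul1r expRD expRN /lnZ lnK//.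
  by rewrite posrE fine_gt0// Z_pos Z_fin.
apply: measurable_fun_fubini_tonelli_G => // p.
by rewrite lee_fin mulr_ge0 ?expR_ge0.
Qed.

Hypothesis H_expm : forall h lam,
  iter_int mu (fun x => (expR (lam * H h x))%:E) < +oo.
Variables (sigma : R).
Hypothesis H_subg : forall lam (k : 'I_n) h x,
  \int[mu]_y (expR (lam * (H h (replace_at x k y)
                 - (\int[mu]_y' H h (replace_at x k y'))%R)))%:E
    <= (expR (lam ^+ 2 * sigma ^+ 2 / 2))%:E.

Let EH h := fine (iter_int mu (fun x => (H h x)%:E)).

Let mH h : measurable_fun [set: n.-tuple T] (H h).
Proof. exact: (measurable_curryl H H_meas). Qed.

(** The exponential moments at 1 and -1 make [H h] integrable, which identifies [EH h] with its mean
    under the product law, as [power_mgf_le] requires. *)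
Lemma hamiltonian_mgf_le h lam :
  \int[power_prob mu n]_x (expR (lam * (H h x - EH h)))%:E <=
  (expR (n%:R * (lam ^+ 2 * sigma ^+ 2 / 2)))%:E.
Proof.
have Hi : (power_prob mu n).-integrable setT (EFin \o H h).
  have mexp lam' : measurable_fun [set: n.-tuple T] (fun x => (expR (lam' * H h x))%:E).
    by apply: measurable_expRE; exact: measurable_funM.
  apply: integrable_expR => //.
    rewrite (eq_integral (fun x => (expR (1 * H h x))%:E)) => [|x _]; last by rewrite mul1r.
    by rewrite -ge0_iter_intE.
  rewrite (eq_integral (fun x => (expR (-1 * H h x))%:E)) => [|x _]; last by rewrite mulN1r.
  by rewrite -ge0_iter_intE.
rewrite /EH (iter_intE mu n _ Hi).
apply: (power_mgf_le mu n (H h)) => // k x; exact: H_subg.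
Qed.

End joint_law.

Theorem theorem8 (R : realType) (d1 d2 : measure_display)
  (T : measurableType d1) (Hs : measurableType d2)
  (mu : probability T R)
  (ev : Hs -> T -> R)
  (ev_meas : measurable_fun [set: Hs * T] (fun p => ev p.1 p.2))
  (ev_ge0 : forall h y, 0 <= ev h y)
  (pi : {measure set Hs -> \bar R})
  (n : nat) (n_gt0 : (0 < n)%N)
  (Q : n.-tuple T -> probability Hs R)
  (H : Hs -> n.-tuple T -> R)
  (H_meas : measurable_fun [set: Hs * n.-tuple T] (fun p => H p.1 p.2))
  (* Hamiltonian *)
  (Z_pos : forall x, (0 < \int[pi]_h (expR (H h x))%:E)%E)
  (Z_fin : forall x, (\int[pi]_h (expR (H h x))%:E < +oo)%E)
  (Q_ham : forall x A, measurable A ->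
     Q x A = (\int[pi]_(h in A)
                (expR (H h x) / fine (\int[pi]_g (expR (H g x))%:E))%:E)%E)
  (* absolute continuity *)
  (Q_ac : forall x, Q x `<< pi /\ pi `<< Q x)
  (* standing assumptions: finite exponential moments *)
  (h_expm : forall h lam, (\int[mu]_y (expR (lam * ev h y))%:E < +oo)%E)
  (H_expm : forall h lam,
     (iter_int mu (fun x => (expR (lam * H h x))%:E) < +oo)%E)
  (Hk_expm : forall h (k : 'I_n) x lam,
     (\int[mu]_y (expR (lam * H h (replace_at x k y)))%:E < +oo)%E)
  (EH_pos : (0 < \int[pi]_h (expR (fine (iter_int mu (fun x => (H h x)%:E))))%:E)%E)
  (EH_fin : (\int[pi]_h (expR (fine (iter_int mu (fun x => (H h x)%:E))))%:E < +oo)%E)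
  (* sub-Gaussian hypotheses *)
  (rho : Hs -> R) (rho_meas : measurable_fun [set: Hs] rho)
  (rho_pos : forall h, 0 < rho h)
  (h_subg : forall h lam,
     (\int[mu]_y (expR (lam * (ev h y - \int[mu]_y' ev h y')))%:E
        <= (expR (lam ^+ 2 * rho h ^+ 2 / 2))%:E)%E)
  (sigma : R) (sigma_pos : 0 < sigma)
  (H_subg : forall lam (k : 'I_n) h x,
     (\int[mu]_y (expR (lam * (H h (replace_at x k y)
                     - \int[mu]_y' H h (replace_at x k y'))))%:E
        <= (expR (lam ^+ 2 * sigma ^+ 2 / 2))%:E)%E)
  (delta : R) (delta_pos : 0 < delta) :
  ((1 - delta)%:E <=
     joint_prob mu Q (fun x h =>
       (gen_gap mu ev h x <=
         rho h * (Num.sqrt 32 * sigma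
                  + Num.sqrt (4 * ln (delta^-1) / n%:R)))%R))%E.
Proof.
have mHx x : measurable_fun [set: Hs] (H^~ x) := measurable_curryr H H_meas x.
(* The finite partition function at one arbitrary sample makes [pi] sigma-finite; [pi'] repackages
   the same measure so that Tonelli's theorem applies. *)
have pi_sf : sigma_finite setT pi.
  apply: (sigma_finite_integrable_gt0 pi (fun h => expR (H h (nseq_tuple n point)))) => //.
  - exact: measurableT_comp.
  - by move=> h; exact: expR_gt0.
pose pi_sfinite := isSFinite.Build _ _ _ _ (sfinite_measure_sigma_finite pi_sf).
pose pi_sigma_finite := isSigmaFinite.Build _ _ _ _ pi_sf.
pose pi' := HB.pack_for {sigma_finite_measure set Hs -> \bar R} (Measure.sort pi)
  pi_sfinite pi_sigma_finite.
(* For [delta >= 1] the left side is nonpositive; in the other case [ln delta^-1] is nonnegative. *)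
have [delta1|delta1] := leP 1 delta.
  apply: (@le_trans _ _ 0%E); first by rewrite lee_fin subr_le0.
  have : forall m (f : m.-tuple T -> \bar R), (forall x, 0 <= f x)%E -> (0 <= iter_int mu f)%E.
    by elim=> [|m IH] f f0 //=; apply: integral_ge0 => x _; exact: IH.
  by apply.
set t := Num.sqrt 32 * sigma + _.
have nR0 : 0 < n%:R :> R by rewrite ltr0n.
have t0 : 0 <= t by rewrite addr_ge0 ?sqrtr_ge0// mulr_ge0 ?sqrtr_ge0// ltW.
(* The minimizer of [lam ^+ 2 / n%:R - lam * t]. *)
pose lam := n%:R * t / 2.
have lam0 : 0 <= lam by rewrite divr_ge0// mulr_ge0// ltW.
(* With these shifts [2 * (a - p)] is [2 * lam * gap / rho - 2 * lam ^+ 2 / n], and [4 * q] is the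
   exponent [8 * n * sigma ^+ 2] of the martingale bound at 4 and -4. *)
pose p := lam ^+ 2 / n%:R - lam * t.
pose q := 2 * n%:R * sigma ^+ 2.
have Kdelta : expR (p + 2 * q) <= delta.
  rewrite -[leRHS]lnK ?posrE// ler_expR.
  have L0 : 0 <= ln delta^-1 by rewrite ln_ge0// invf_ge1// ltW.
  have := chernoff_exponent_le R n%:R sigma (ln delta^-1) nR0 (ltW sigma_pos) L0.
  rewrite -/t lnV ?posrE// opprK; apply: le_trans.
  rewrite le_eqVlt; apply/orP; left; apply/eqP; rewrite /p /q /lam.
  by field; rewrite gt_eqF.
pose EH h : R := fine (iter_int mu (fun x => (H h x)%:E)).
have mEH : measurable_fun [set: Hs] EH.
  apply: measurableT_comp => //.
  apply: (measurable_iter_int mu n _ _ (fun p => (H p.1 p.2)%:E)).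
  exact/measurable_EFinP.
pose a h (x : n.-tuple T) : R := lam * (gen_gap mu ev h x / rho h - t).
pose gap (z : Hs * n.-tuple T) : R := gen_gap mu ev z.1 z.2.
have mgap : measurable_fun [set: Hs * n.-tuple T] gap := measurable_gen_gap mu ev ev_meas n.
have ma : measurable_fun [set: Hs * n.-tuple T] (fun z => a z.1 z.2).
  apply: measurable_funM => //; apply: measurable_funB => //.
  (* Positivity of [rho] lets the division be written with [expR] and [ln], which are measurable. *)
  rewrite (_ : (fun z => _) = fun z => gap z * expR (- ln (rho z.1))); last first.
    by apply/funext => z; rewrite expRN lnK// posrE.
  apply: measurable_funM => //; apply: measurableT_comp => //.
  apply: measurableT_comp => //; apply: measurableT_comp => //.
  exact: measurableT_comp.
have mEH1 : measurable_fun [set: Hs * n.-tuple T] (fun z => EH z.1).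
  exact: measurableT_comp.
pose F h x : R := expR (EH h) *
   (2^-1 * expR (2 * (a h x - p)) + 4^-1 * expR (4 * (H h x - EH h - q))
      + 4^-1 * expR (4 * (EH h - H h x - q))).
have mF : measurable_fun [set: Hs * n.-tuple T] (fun z => (F z.1 z.2)%:E).
  apply/measurable_EFinP; apply: measurable_funM; first exact: measurableT_comp.
  by apply: measurable_funD; [apply: measurable_funD|]; apply: measurable_funM => //;
    apply: measurableT_comp => //; apply: measurable_funM => //;
    apply: measurable_funB => //; apply: measurable_funB.
have F0 h x : 0 <= F h x.
  by rewrite mulr_ge0 ?expR_ge0// !addr_ge0// mulr_ge0 ?expR_ge0// invr_ge0.
have F0z (z : Hs * n.-tuple T) : (0 <= (F z.1 z.2)%:E)%E by rewrite lee_fin.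
have mFx : measurable_fun [set: n.-tuple T] (fun x => \int[pi']_h (F h x)%:E)%E :=
  measurable_fun_fubini_tonelli_G (m1 := pi') _ mF F0z.
pose E (x : n.-tuple T) h := gen_gap mu ev h x <= rho h * t.
have mE : measurable [set z : Hs * n.-tuple T | E z.2 z.1].
  apply: measurable_set_ler => //; apply: measurable_funM => //.
  exact: measurableT_comp.
have mEx x : measurable [set h | E x h].
  rewrite (_ : [set h | _] = ysection [set z : Hs * n.-tuple T | E z.2 z.1] x).
    exact: measurable_ysection.
  by apply/seteqP; split => h; rewrite /ysection /= inE.
(* For fixed [h] the three normalized exponentials have sample mean at most 1, which leaves the
   weight [expR (EH h)]. *)
have FE h : (\int[power_prob mu n]_x (F h x)%:E <= (expR (EH h))%:E)%E.
  have mHh : measurable_fun [set: n.-tuple T] (H h) := measurable_curryl H H_meas h.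
  have mgh : measurable_fun [set: n.-tuple T] (fun x => gen_gap mu ev h x).
    exact: (measurable_curryl (fun h (x : n.-tuple T) => gen_gap mu ev h x) mgap).
  have mH4 (c : R) : measurable_fun [set: n.-tuple T] (fun x => c * (H h x - EH h)).
    by apply: measurable_funM => //; exact: measurable_funB.
  rewrite (eq_integral (fun x => (expR (EH h))%:E *
    (2^-1 * expR (2 * lam / rho h * gen_gap mu ev h x - 2 * lam ^+ 2 / n%:R)
     + 4^-1 * expR (4 * (H h x - EH h) - 4 * q)
     + 4^-1 * expR (-4 * (H h x - EH h) - 4 * q))%:E)%E) => [|x _]; last first.
    rewrite -EFinM; congr (_ * (_ * expR _ + _ * expR _ + _ * expR _))%:E.
    - by rewrite /a /p; field; rewrite !gt_eqF.
    - by ring.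
    - by ring.
  rewrite ge0_integralZl//; last first.
    apply/measurable_EFinP; apply: measurable_funD; [apply: measurable_funD|];
      apply: measurable_funM => //; apply: measurableT_comp => //;
      apply: measurable_funB => //; exact: measurable_funM.
  rewrite -[leRHS]mule1 lee_wpmul2l ?lee_fin ?expR_ge0//.
  apply: integral_expR_mix_le.
  - by apply: measurable_funB => //; exact: measurable_funM.
  - exact: measurable_funB.
  - exact: measurable_funB.
  - apply: integral_expRB_le; first exact: measurable_funM.
    (* At [2 * lam / rho h] the factor [rho h ^+ 2] cancels, so the bound is uniform in [h]. *)
    apply: le_trans (gen_gap_mgf_le mu ev ev_meas n h (rho h) n_gt0 (h_subg h) _) _.
    rewrite lee_fin ler_expR le_eqVlt; apply/orP; left; apply/eqP.
    by field; rewrite !gt_eqF.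
  - apply: integral_expRB_le => //.
    apply: le_trans (hamiltonian_mgf_le mu n H H_meas H_expm sigma H_subg h _) _.
    rewrite lee_fin ler_expR le_eqVlt; apply/orP; left; apply/eqP.
    by rewrite /q; field.
  - apply: integral_expRB_le => //.
    apply: le_trans (hamiltonian_mgf_le mu n H H_meas H_expm sigma H_subg h _) _.
    rewrite lee_fin ler_expR le_eqVlt; apply/orP; left; apply/eqP.
    by rewrite /q; field.
pose Z0 := fine (\int[pi]_h (expR (EH h))%:E)%E.
have Z0_gt0 : 0 < Z0 by rewrite fine_gt0// EH_pos EH_fin.
have Z0E : (\int[pi]_h (expR (EH h))%:E)%E = Z0%:E.
  by rewrite fineK// ge0_fin_numE// integral_expR_ge0.
apply: joint_prob_ge => //.
  exact: (measurable_gibbs_section n Q pi' H H_meas Z_pos Z_fin Q_ham _ mE).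
apply: (@le_trans _ _ (\int[power_prob mu n]_x
  ((expR (p + 2 * q) / Z0)%:E * \int[pi']_h (F h x)%:E))%E).
  apply: ge0_le_integral => //.
  - apply: (measurable_gibbs_section n Q pi' H H_meas Z_pos Z_fin Q_ham (~` [set z | E z.2 z.1])).
    exact: measurableC.
  - exact: measurable_funeM.
  move=> x _; rewrite Q_ham; last exact: measurableC (mEx x).
  apply: (gibbs_event_le pi (H^~ x) EH) => //.
  - by rewrite fineK// ge0_fin_numE// integral_expR_ge0.
  - by rewrite fine_gt0// Z_pos Z_fin.
  - exact: (measurable_curryr a ma).
  - exact: measurableC (mEx x).
  (* On the bad event the gap exceeds [rho h * t], which is the required sign of [a]. *)
  - move=> h /negP; rewrite -ltNge => bad; rewrite mulr_ge0// subr_ge0.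
    by rewrite ler_pdivlMr// mulrC ltW.
rewrite ge0_integralZl//; last 2 first.
- by move=> x _; apply: integral_ge0 => h _; rewrite lee_fin.
- by rewrite lee_fin divr_ge0 ?expR_ge0 ?ltW.
(* The sample is now integrated first, as in [FE]; the remaining weights integrate to [Z0] and
   cancel the denominator of the prefactor. *)
rewrite -(fubini_tonelli _ mF F0z).
apply: (@le_trans _ _ ((expR (p + 2 * q) / Z0)%:E * Z0%:E)%E); last first.
  by rewrite -EFinM divfK ?gt_eqF// lee_fin.
apply: lee_wpmul2l; first by rewrite lee_fin divr_ge0 ?expR_ge0 ?ltW.
rewrite -Z0E; apply: ge0_le_integral => //.
- by move=> h _; apply: integral_ge0 => x _; rewrite lee_fin.
- exact: (measurable_fun_fubini_tonelli_F _ mF F0z).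
- exact: measurable_expRE.
- by move=> h _; exact: FE.
Qed.
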